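(* Let $B$ be a simple Bratteli diagram, and let $\mu$ be any probability ergodic $\mathcal E$-invariant measure on $X_B$. Suppose that $\overline B$ is a vertex subdiagram of $B$ defined by a sequence $(W_n)$ of subsets of $V_n$. Then $\mu(X_{\overline B}) = 0$ if and only if for every $\varepsilon > 0$ there exists $n = n(\varepsilon)$ such that for all $w \in W_n$ one has $$\frac{\overline h_w^{(n)}}{h_w^{(n)}} < \varepsilon .$$
   Context: A Bratteli diagram $B=(V,E)$ is an infinite graph with $V=\bigcup_{i\ge 0}V_i$, $E=\bigcup_{i\ge1}E_i$ (disjoint finite levels, $V_0=\{v_0\}$), with range and source maps $r,s$ on edges such that $r(E_i)=V_i$, $s(E_i)=V_{i-1}$, $s^{-1}(v)\ne\emptyset$ for all $v$, and $r^{-1}(v)\neq\emptyset$ for all $v\ne v_0$. $B$ is simple if for every $n$ there is $m>n$ such that every vertex of $V_n$ is joined by a finite path to every vertex of $V_m$. $X_B$ is the space of infinite paths starting at $v_0$ with the cylinder topology, assumed to be a Cantor set. Two paths are tail equivalent, $(x,y)\in\mathcal E$, if they agree from some index on. A measure is $\mathcal E$-invariant if any two cylinder sets given by finite paths from $v_0$ to the same vertex have equal measure; ergodic means ergodic with respect to $\mathcal E$. A vertex subdiagram $\overline B$ is given by proper nonempty subsets $W_n\subset V_n$ ($n\ge1$) (and $v_0$ at level $0$): its edges are all edges of $B$ with source in $W_n$ and range in $W_{n+1}$, together with the edges from $v_0$ to $W_1$. It is required that every vertex of $\overline B$ is the source of some edge of $\overline B$ and every vertex of $\overline B$ other than $v_0$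 is the range of some edge of $\overline B$. $X_{\overline B}\subset X_B$ is its set of infinite paths. $h^{(n)}_w$ (resp. $\overline h^{(n)}_w$) is the number of finite paths in $B$ (resp. in $\overline B$) from $v_0$ to $w$.
   Formalization: The equivalence is stated with ''μ(X_B̄)=0 for every ergodic invariant probability measure μ'' on the left side, because for a single fixed μ the implication from μ(X_B̄)=0 to the ratio condition is false when there are several ergodic measures. *)

(* Defs.v *)
From HB Require Import structures.
From mathcomp Require Import all_boot all_order all_algebra.
From mathcomp Require Import all_classical all_reals all_analysis.

Set Implicit Arguments.
Unset Strict Implicit.
Unset Printing Implicit Defensive.

Local Open Scope classical_set_scope.
Local Open Scope ring_scope.

(* [edge n] is the set E_(n+1) of edges from level n to level n.+1. *)
Record bratteli := Bratteli {
  vertex : nat -> finType;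
  edge : nat -> finType;
  src : forall n, edge n -> vertex n;
  rng : forall n, edge n -> vertex n.+1;
  root_vertex : vertex 0;
  root_unique : forall v : vertex 0, v = root_vertex;
  src_onto : forall n (v : vertex n), exists e : edge n, src e = v;
  rng_onto : forall n (w : vertex n.+1), exists e : edge n, rng e = w
}.

Arguments src {b n} e.
Arguments rng {b n} e.

(* [joined v w]: some finite path of edges leads from v down to w. *)
Inductive joined (B : bratteli) n (v : vertex B n) :
    forall m, vertex B m -> Prop :=
| joined_refl : joined v v
| joined_step m (e : edge B m) : joined v (src e) -> joined v (rng e).

Definition simple (B : bratteli) : Prop :=
  forall n, exists2 m, (n < m)%N &
    forall (v : vertex B n) (w : vertex B m), joined v w.

Section FinitePaths.
Variable B : bratteli.

Definition edge_seq n := {dffun forall i : 'I_n, edge B i}.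

(* Edge number 0 starts at the root automatically, by [root_unique]. *)
Definition is_fpath n (p : edge_seq n) : Prop :=
  forall i (lt_i : (i.+1 < n)%N),
    rng (p (Ordinal (ltnW lt_i))) = src (p (Ordinal lt_i)).

Definition end_vertex n : edge_seq n -> vertex B n :=
  match n with
  | 0 => fun _ => root_vertex B
  | k.+1 => fun p => rng (p ord_max)
  end.

Definition paths_to n (w : vertex B n) : {set edge_seq n} :=
  [set p | `[< is_fpath p >] && (end_vertex p == w)]%SET.

Definition height n (w : vertex B n) : nat := #|paths_to w|.

End FinitePaths.

Record bpath (B : bratteli) := BPath {
  bpath_edge :> forall n, edge B n;
  bpathP : forall n, rng (bpath_edge n) = src (bpath_edge n.+1)
}.

Definition cylinder (B : bratteli) n (p : edge_seq B n) : set (bpath B) :=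
  [set x : bpath B | forall i : 'I_n, x i = p i].

Definition cylinders (B : bratteli) : set (set (bpath B)) :=
  [set C | exists n (p : edge_seq B n), is_fpath p /\ C = cylinder p].

Lemma bpath_inhabited (B : bratteli) : inhabited (bpath B).
Proof.
have nextP n (e : edge B n) : {e' : edge B n.+1 | rng e = src e'}.
  by apply/cid; have [e' <-] := src_onto (rng e); exists e'.
have [e0 _] := cid (src_onto (root_vertex B)).
pose f := fix f n : edge B n :=
  match n with 0 => e0 | k.+1 => sval (nextP k (f k)) end.
by split; exists f => n /=; exact: (svalP (nextP n (f n))).
Qed.

HB.instance Definition _ (B : bratteli) := gen_eqMixin (bpath B).
HB.instance Definition _ (B : bratteli) := gen_choiceMixin (bpath B).
HB.instance Definition _ (B : bratteli) :=
  isPointed.Build (bpath B) (inhabited_witness (bpath_inhabited B)).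

Definition truncate (B : bratteli) n (x : bpath B) : edge_seq B n :=
  [ffun i : 'I_n => x i].

Lemma is_fpath_truncate (B : bratteli) n (x : bpath B) :
  is_fpath (truncate n x).
Proof. by move=> i lt_i; rewrite !ffunE bpathP. Qed.

Lemma cylinder_truncate (B : bratteli) n (x : bpath B) :
  cylinder (truncate n x) x.
Proof. by move=> i; rewrite ffunE. Qed.

Lemma cylinders_cover (B : bratteli) : \bigcup_(C in @cylinders B) C = setT.
Proof.
rewrite -subTset => x _; exists (cylinder (truncate 0 x)).
  by exists 0%N, (truncate 0 x); split; [exact: is_fpath_truncate|].
exact: cylinder_truncate.
Qed.

Lemma cylinders_join (B : bratteli) (C D : set (bpath B)) x :
  cylinders C -> cylinders D -> C x -> D x ->
  exists A, [/\ cylinders A, A x & A `<=` C `&` D].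
Proof.
move=> [n [p [_ ->]]] [m [q [_ ->]]] xp xq.
exists (cylinder (truncate (maxn n m) x)); split.
- exists (maxn n m), (truncate (maxn n m) x).
  by split; [exact: is_fpath_truncate|].
- exact: cylinder_truncate.
- move=> y xy; split => i.
  + have := xy (widen_ord (leq_maxl n m) i).
    by rewrite ffunE /= => ->; exact: xp.
  + have := xy (widen_ord (leq_maxr n m) i).
    by rewrite ffunE /= => ->; exact: xq.
Qed.

HB.instance Definition _ (B : bratteli) :=
  isBaseTopological.Build (bpath B) (@cylinders_cover B) (@cylinders_join B).

Definition borel_bpath (B : bratteli) := g_sigma_algebraType (@open (bpath B)).

Definition tail_equivalent (B : bratteli) (x y : bpath B) : Prop :=
  exists N, forall n, (N <= n)%N -> x n = y n.

Definition tail_invariant (B : bratteli) (R : realType)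
    (mu : set (borel_bpath B) -> \bar R) : Prop :=
  forall n (w : vertex B n) (p q : edge_seq B n),
    p \in paths_to w -> q \in paths_to w -> mu (cylinder p) = mu (cylinder q).

Definition tail_ergodic (B : bratteli) (R : realType)
    (mu : probability (borel_bpath B) R) : Prop :=
  forall A : set (borel_bpath B), measurable A ->
    (forall x y : bpath B, tail_equivalent x y -> A x -> A y) ->
    mu A = 0%E \/ mu A = 1%E.

(* [vset 0] is the root level, so the edges from the root into [vset 1] are
   covered by the same condition as the deeper edges. *)
Definition induced_edge (B : bratteli) (W : forall n, {set vertex B n})
    n (e : edge B n) : bool :=
  (src e \in W n) && (rng e \in W n.+1).

Record vertex_subdiagram (B : bratteli) := VertexSubdiagram {
  vset : forall n, {set vertex B n};
  vset_root : vset 0 = [set root_vertex B]%SET;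
  vset_neq0 : forall n, vset n.+1 != finset.set0;
  vset_proper : forall n, vset n.+1 \proper [set: vertex B n.+1]%SET;
  vset_source : forall n (v : vertex B n), v \in vset n ->
    exists2 e : edge B n, induced_edge vset e & src e = v;
  vset_range : forall n (w : vertex B n.+1), w \in vset n.+1 ->
    exists2 e : edge B n, induced_edge vset e & rng e = w
}.

Definition sub_paths_to (B : bratteli) (S : vertex_subdiagram B)
    n (w : vertex B n) : {set edge_seq B n} :=
  [set p in paths_to w | [forall i : 'I_n, induced_edge (vset S) (p i)]]%SET.

Definition sub_height (B : bratteli) (S : vertex_subdiagram B)
    n (w : vertex B n) : nat := #|sub_paths_to S w|.

Definition sub_bpaths (B : bratteli) (S : vertex_subdiagram B) :
    set (bpath B) :=
  [set x : bpath B | forall n, induced_edge (vset S) (x n)].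

(* Main.v *)
From HB Require Import structures.
Require Import Defs.
From mathcomp Require Import all_boot all_order all_algebra.
From mathcomp Require Import all_classical all_reals all_analysis.
From mathcomp Require Import lra.

Set Implicit Arguments.
Unset Strict Implicit.
Unset Printing Implicit Defensive.
Import Order.TTheory GRing.Theory Num.Theory.
Import numFieldNormedType.Exports.
Local Open Scope classical_set_scope.
Local Open Scope ring_scope.

(** An invariant measure is the same thing as a weight on vertices: a function
    u >= 0 with u(root) = 1 and u(v) equal to the sum of u(range e) over the
    edges e leaving v; u(w) is the common measure of the cylinders of the
    finite paths from the root to w. Grouping paths by their end vertex,
    the paths that stay in the subdiagram for n steps have measure
      k_n(u) = sum_w hbar_w u(w),   while   sum_w h_w u(w) = 1.

    If hbar_w / h_w < eps for all w in W_n, these two identities give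
    mu(X_S) <= k_n <= eps, whence mu(X_S) = 0 for every invariant mu
    ([small_ratio_null]).

    Conversely, suppose that for some eps > 0 each level n > 0 has a vertex w_n
    in W_n with hbar / h >= eps. The uniform distribution on the paths from the
    root to w_n defines a function that satisfies the harmonic equations below
    level n and has k_j >= eps for all j <= n, because k_j decreases in j. By
    Tychonoff these functions have a cluster point, which is a weight u with
    k_j(u) >= eps for all j ([exists_weight]), that is, an invariant measure
    with mu(X_S) >= eps.

    It remains to make the measure ergodic without losing mass. The value
    inf_n k_n(u) = mu(X_S) is upper semicontinuous in u. On the compact set of
    weights, maximise first this value and then, successively among the
    maximisers so far, each of the countably many coordinates u(v). A weight
    that survives all these stages cannot be a proper convex combination of
    two other weights ([extreme_point]). The measure of this weight is
    ergodic: a tail-closed Borel set A with 0 < mu(A) < 1 would split it into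
    the two conditional measures on A and on its complement, which are again
    invariant ([tail_closed_invariant]), so that mu = mu( . | A) and mu(A) = 1
    ([exists_ergodic]).

    A weight is turned into a measure by defining a set function on the
    algebra of sets that depend on finitely many edges; compactness of the path
    space makes it countably additive, and Caratheodory's theorem extends it
    to the Borel sets ([weight_measure]). *)

(** * Finite paths and their extensions *)

Section Splicing.
Variable B : bratteli.

(** The first [n] edges are those of [p], the later ones those of [d]. Spelling
    it out on arbitrary families of edges, composable or not, lets one formula
    serve both for appending an edge to [p] and for rerouting an infinite
    path. *)
Definition splice n (p : edge_seq B n) (d : forall i, edge B i) (i : nat) :
    edge B i :=
  if (i < n)%N =P true is ReflectT lt_i then p (Ordinal lt_i) else d i.

Lemma edge_seq_irrelevance n (p : edge_seq B n) i (lt_i lt_i' : (i < n)%N) :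
  p (Ordinal lt_i) = p (Ordinal lt_i').
Proof. by rewrite (bool_irrelevance lt_i lt_i'). Qed.

Lemma splice_lt n (p : edge_seq B n) d i (lt_i : (i < n)%N) :
  splice p d i = p (Ordinal lt_i).
Proof.
rewrite /splice; case: eqP => [h|/(_ lt_i)//].
by rewrite (bool_irrelevance h lt_i).
Qed.

Lemma splice_ord n (p : edge_seq B n) d (i : 'I_n) : splice p d i = p i.
Proof. by case: i => i lt_i; rewrite (splice_lt _ _ lt_i). Qed.

Lemma splice_ge n (p : edge_seq B n) d i : (n <= i)%N -> splice p d i = d i.
Proof. by rewrite /splice; case: eqP => // h; rewrite leqNgt h. Qed.

Lemma is_fpathP n (p : edge_seq B n) d :
  is_fpath p <->
  forall i, (i.+1 < n)%N -> rng (splice p d i) = src (splice p d i.+1).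
Proof.
split=> [fp i lt_i|fp i lt_i].
  by rewrite (splice_lt _ _ (ltnW lt_i)) (splice_lt _ _ lt_i) fp.
by have := fp _ lt_i; rewrite (splice_lt _ _ (ltnW lt_i)) (splice_lt _ _ lt_i).
Qed.

Lemma end_vertexS n (p : edge_seq B n.+1) d :
  end_vertex p = rng (splice p d n).
Proof.
by rewrite -[n in splice p d n]/(nat_of_ord (@ord_max n)) splice_ord.
Qed.

Lemma splice_bpathP n (p : edge_seq B n) (x : bpath B) :
  is_fpath p -> end_vertex p = src (x n) ->
  forall i, rng (splice p x i) = src (splice p x i.+1).
Proof.
move=> fp endp i; have [lt_i|] := ltnP i.+1 n.
  exact: (is_fpathP p x).1.
rewrite leq_eqVlt => /orP[/eqP def_n|le_n].
  by subst n; rewrite -end_vertexS splice_ge.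
by rewrite !splice_ge ?bpathP// ltnW.
Qed.

(** Every vertex emits an edge, so a finite path never gets stuck. *)
Lemma bpath_extends n (p : edge_seq B n) :
  is_fpath p -> exists x : bpath B, truncate n x = p.
Proof.
move=> fp; have nextP k (e : edge B k) : {e' : edge B k.+1 | rng e = src e'}.
  by apply/cid; have [e' <-] := src_onto (rng e); exists e'.
have [f f_lt f_next] : exists2 f : forall k, edge B k,
    forall k (lt_k : (k < n)%N), f k = p (Ordinal lt_k) &
    forall k, (n <= k.+1)%N -> rng (f k) = src (f k.+1).
  pose f := fix f k : edge B k :=
    if (k < n)%N =P true is ReflectT lt_k then p (Ordinal lt_k) else
    match k with
    | 0 => (point : bpath B) 0
    | k'.+1 => sval (nextP k' (f k'))
    end.
  exists f => [[|k] lt_k /=|k le_n /=].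
  - by case: eqP => [h|/(_ lt_k)//]; rewrite (bool_irrelevance h lt_k).
  - by case: eqP => [h|/(_ lt_k)//]; rewrite (bool_irrelevance h lt_k).
  - case: eqP => [h|_]; last exact: (svalP (nextP k (f k))).
    by exfalso; rewrite ltnNge le_n in h.
have fP k : rng (f k) = src (f k.+1).
  have [lt_k|le_n] := ltnP k.+1 n; last exact: f_next.
  by rewrite (f_lt _ (ltnW lt_k)) (f_lt _ lt_k) fp.
by exists (BPath fP); apply/ffunP => -[i lt_i]; rewrite ffunE /= f_lt.
Qed.

(** A chosen point of the cylinder of [p], used to test membership of the
    cylinder in a set that depends on the first [n] edges only. *)
Definition extension n (p : edge_seq B n) : bpath B :=
  get [set x | truncate n x = p].

Lemma extensionK n (p : edge_seq B n) :
  is_fpath p -> truncate n (extension p) = p.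
Proof. by move=> /bpath_extends /(@getPex _ [set x | truncate n x = p]). Qed.

Lemma end_truncate n (x : bpath B) : end_vertex (truncate n x) = src (x n).
Proof.
case: n => [|n]; first by rewrite [RHS]root_unique.
by rewrite (end_vertexS _ x) (splice_lt _ _ (ltnSn n)) ffunE bpathP.
Qed.

Lemma cylinderE n (p : edge_seq B n) : cylinder p = [set x | truncate n x = p].
Proof.
apply/seteqP; split=> x.
  by move=> xp; apply/ffunP => i; rewrite ffunE xp.
by move=> /= <-; exact: cylinder_truncate.
Qed.

Lemma cylinder_extension n (p : edge_seq B n) :
  is_fpath p -> cylinder p (extension p).
Proof. by move=> fp; rewrite cylinderE /= extensionK. Qed.

Definition init n (r : edge_seq B n.+1) : edge_seq B n :=
  [ffun i : 'I_n => r (widen_ord (leqnSn n) i)].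

(** Only position [n] of the second argument of [splice] is read; the edges of
    [point] fill the other positions. *)
Definition append n (p : edge_seq B n) (e : edge B n) : edge_seq B n.+1 :=
  [ffun i : 'I_n.+1 => splice p (dfwith (point : bpath B) n e) i].

Lemma splice_append n (p : edge_seq B n) e d i : (i < n)%N ->
  splice (append p e) d i = splice p d i.
Proof.
move=> lt_i; have lt_i' : (i < n.+1)%N by rewrite ltnW.
by rewrite (splice_lt _ _ lt_i') ffunE /= !(splice_lt _ _ lt_i).
Qed.

Lemma splice_append_last n (p : edge_seq B n) e d : splice (append p e) d n = e.
Proof. by rewrite (splice_lt _ _ (ltnSn n)) ffunE /= splice_ge// dfwithin. Qed.

Lemma appendK n (p : edge_seq B n) e : init (append p e) = p.
Proof. by apply/ffunP => i; rewrite !ffunE /= splice_ord. Qed.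

Lemma append_last n (p : edge_seq B n) e : append p e ord_max = e.
Proof. by rewrite ffunE /= splice_ge// dfwithin. Qed.

Lemma initK n (r : edge_seq B n.+1) : append (init r) (r ord_max) = r.
Proof.
apply/ffunP => -[i lt_i]; rewrite ffunE /=; have [lt_in|le_n] := ltnP i n.
  by rewrite (splice_lt _ _ lt_in) ffunE; exact: edge_seq_irrelevance.
have def_i : i = n by apply/eqP; rewrite eqn_leq le_n -ltnS lt_i.
by subst i; rewrite splice_ge// dfwithin; exact: edge_seq_irrelevance.
Qed.

Lemma init_truncate n (x : bpath B) : init (truncate n.+1 x) = truncate n x.
Proof. by apply/ffunP => i; rewrite !ffunE. Qed.

Lemma is_fpath_append n (p : edge_seq B n) e :
  is_fpath (append p e) <-> is_fpath p /\ src e = end_vertex p.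
Proof.
have d : bpath B := point.
split.
  move=> /bpath_extends[x xpe]; split.
    by rewrite -(appendK p e) -xpe init_truncate; exact: is_fpath_truncate.
  have <- : x n = e by rewrite -(append_last p e) -xpe ffunE.
  by rewrite -(appendK p e) -xpe init_truncate end_truncate.
move=> [fp se]; apply/(is_fpathP _ d) => i; rewrite ltnS => lt_i.
move: (lt_i); rewrite leq_eqVlt => /orP[/eqP def_n|lt_i1]; last first.
  by rewrite !splice_append// ((is_fpathP p d).1 fp).
by subst n; rewrite splice_append_last splice_append// se (end_vertexS _ d).
Qed.

Lemma edge_seq0 (p q : edge_seq B 0) : p = q.
Proof. by apply/ffunP => -[]. Qed.

Lemma paths_toP n (w : vertex B n) : exists p, p \in paths_to w.
Proof.
elim: n w => [|n IHn] w.
  exists (truncate 0 (point : bpath B)).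
  by rewrite inE asboolT//= eq_sym; apply/eqP; exact: root_unique.
have [e <-] := rng_onto w; have [p] := IHn (src e).
rewrite inE => /andP[/asboolP fp /eqP endp].
exists (append p e); rewrite inE asboolT ?is_fpath_append//=.
by rewrite append_last.
Qed.

(** Arguing on truncations of infinite paths avoids the dependent types and the
    case distinction at level 0 in the definition of [end_vertex]. *)
Lemma fpath_truncate n (p : edge_seq B n) : is_fpath p ->
  exists2 x : bpath B, p = truncate n x & end_vertex p = src (x n).
Proof. by move=> /bpath_extends[x <-]; exists x; rewrite ?end_truncate. Qed.

End Splicing.

(** * Sets determined by finitely many edges *)

Section Determined.
Variable B : bratteli.
Implicit Types (x y : bpath B) (A : set (bpath B)).

Lemma eq_truncateP n x y :
  truncate n x = truncate n y <-> forall i, (i < n)%N -> x i = y i.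
Proof.
split=> [exy i lt_i|exy].
  by have /ffunP/(_ (Ordinal lt_i)) := exy; rewrite !ffunE.
by apply/ffunP => i; rewrite !ffunE exy.
Qed.

Lemma eq_truncate_le m n x y : (m <= n)%N ->
  truncate n x = truncate n y -> truncate m x = truncate m y.
Proof.
move=> le_mn /eq_truncateP exy; apply/eq_truncateP => i lt_i.
exact/exy/(leq_trans lt_i).
Qed.

Definition determined n A :=
  forall x y, truncate n x = truncate n y -> A x -> A y.

Lemma determinedP n A x y : determined n A ->
  truncate n x = truncate n y -> A x <-> A y.
Proof. by move=> dA exy; split; apply: dA. Qed.

Lemma determined_le m n A : (m <= n)%N -> determined m A -> determined n A.
Proof. by move=> le_mn dA x y /(eq_truncate_le le_mn); exact: dA. Qed.

Lemma determinedC n A : determined n A -> determined n (~` A).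
Proof. by move=> dA x y exy nAx Ay; apply: nAx; apply: dA Ay. Qed.

Lemma determinedU n A A' :
  determined n A -> determined n A' -> determined n (A `|` A').
Proof.
by move=> dA dA' x y exy [/(dA _ _ exy)|/(dA' _ _ exy)]; [left|right].
Qed.

Lemma determinedI n A A' :
  determined n A -> determined n A' -> determined n (A `&` A').
Proof. by move=> dA dA' x y exy [/(dA _ _ exy) ? /(dA' _ _ exy)]. Qed.

Lemma determined_cylinder n (p : edge_seq B n) : determined n (cylinder p).
Proof. by move=> x y exy; rewrite cylinderE /= => <-. Qed.

(** These are the clopen sets when the path space is compact; this description
    makes the closure under Boolean operations immediate. *)
Definition finite_stage : set (set (bpath B)) :=
  [set A | exists n, determined n A].

Lemma finite_stageI : setI_closed finite_stage.
Proof.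
move=> A A' [m dA] [n dA']; exists (maxn m n).
apply: determinedI.
  exact: determined_le (leq_maxl m n) dA.
exact: determined_le (leq_maxr m n) dA'.
Qed.

Lemma finite_stageU : setU_closed finite_stage.
Proof.
move=> A A' [m dA] [n dA']; exists (maxn m n).
apply: determinedU.
  exact: determined_le (leq_maxl m n) dA.
exact: determined_le (leq_maxr m n) dA'.
Qed.

Lemma finite_stageC : setC_closed finite_stage.
Proof. by move=> A [n dA]; exists n; exact: determinedC. Qed.

Lemma finite_stageT : finite_stage setT.
Proof. by exists 0%N. Qed.

Lemma finite_stage0 : finite_stage set0.
Proof. by exists 0%N. Qed.

Lemma open_finite_stage A : finite_stage A -> open A.
Proof.
move=> [n dA]; exists [set cylinder (truncate n x) | x in A].
  move=> _ [x Ax <-]; exists n, (truncate n x).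
  by split=> //; exact: is_fpath_truncate.
apply/seteqP; split=> [y [_ [x Ax <-]]|x Ax].
  by rewrite cylinderE /= => exy; exact: dA Ax.
by exists (cylinder (truncate n x)); [exists x | exact: cylinder_truncate].
Qed.

Lemma open_cylinder_sub A x : open A -> A x ->
  exists n, cylinder (truncate n x) `<=` A.
Proof.
move=> [D sD <-] [C DC Cx]; have [n [p [_ defC]]] := sD _ DC.
exists n => y; rewrite cylinderE /= => exy; exists C => //.
by move: Cx; rewrite defC /= !cylinderE /= exy.
Qed.

(** The paths whose cylinder of level [n] lies in an open set [A] form a set
    determined at level [n], and [A] is the countable union of these. *)
Lemma borel_finite_stage : @measurable _ (borel_bpath B) = <<s finite_stage >>.
Proof.
apply/seteqP; split; last first.
  by apply: sub_smallest2r => // A /open_finite_stage.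
apply: smallest_sub; first exact: smallest_sigma_algebra.
move=> A oA.
have -> : A = \bigcup_n [set x | cylinder (truncate n x) `<=` A].
  apply/seteqP; split=> [x Ax|x [n _]].
    by have [n nA] := open_cylinder_sub oA Ax; exists n.
  by apply; exact: cylinder_truncate.
apply: sigma_algebra_bigcup => n; apply: sub_gen_smallest.
by exists n => x y /= ->.
Qed.

Lemma measurable_finite_stage A :
  finite_stage A -> @measurable _ (borel_bpath B) A.
Proof. by rewrite borel_finite_stage; exact: sub_gen_smallest. Qed.

Lemma measurable_cylinder n (p : edge_seq B n) :
  @measurable _ (borel_bpath B) (cylinder p).
Proof.
by apply: measurable_finite_stage; exists n; exact: determined_cylinder.
Qed.

Lemma extension_truncate n A x : determined n A ->
  A (extension (truncate n x)) <-> A x.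
Proof.
move=> dA; apply: (determinedP dA); rewrite extensionK//.
exact: is_fpath_truncate.
Qed.

Lemma measure_determined (R : realType)
    (nu : {measure set (borel_bpath B) -> \bar R}) n A : determined n A ->
  nu A = (\sum_(p : edge_seq B n | `[< is_fpath p >] && (extension p \in A))
           nu (cylinder p))%E.
Proof.
move=> dA; pose P := [pred p : edge_seq B n |
  `[< is_fpath p >] && (extension p \in A)].
have {1}-> : A = \bigcup_(p in [set` enum P]) cylinder p.
  apply/seteqP; split=> [x Ax|x [p /=]].
    exists (truncate n x); last exact: cylinder_truncate.
    rewrite /= mem_enum inE; apply/andP; split.
      exact/asboolP/is_fpath_truncate.
    exact/mem_set/extension_truncate.
  rewrite mem_enum inE => /andP[/asboolP fp /set_mem Ap].
  by rewrite cylinderE /= => xp; apply: dA Ap; rewrite extensionK.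
rewrite measure_fin_bigcup//; last 2 first.
- by move=> p q _ _ [x []]; rewrite !cylinderE /= => <-.
- by move=> p _; exact: measurable_cylinder.
by rewrite -fsbig_seq ?enum_uniq//= big_enum; apply: eq_bigl => p; rewrite inE.
Qed.

(** The lower bound [N] on the levels is free, since cylinders of small level
    split into cylinders of level at least [N]; it spares the comparison of
    short paths with the path being rerouted in [reroute_invariant]. *)
Lemma eq_measure_cylinder (R : realType) N
    (nu nu' : {measure set (borel_bpath B) -> \bar R}) :
  (nu setT < +oo)%E ->
  (forall n (p : edge_seq B n), (N <= n)%N -> is_fpath p ->
    nu (cylinder p) = nu' (cylinder p)) ->
  forall A, @measurable _ (borel_bpath B) A -> nu A = nu' A.
Proof.
move=> fin_nu eq_cyl A mA.
apply: (@measure_unique _ R (borel_bpath B) finite_stage (fun=> setT)) => //.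
- exact: borel_finite_stage.
- exact: finite_stageI.
- by move=> _; exact: finite_stageT.
- by rewrite bigcup_const.
move=> C [n /(determined_le (leq_maxl n N)) dC].
rewrite !(measure_determined _ dC); apply: eq_bigr => p /andP[/asboolP fp _].
by rewrite eq_cyl ?leq_maxr.
Qed.

End Determined.

(** * Sums over finite paths *)

Section Mass.
Variables (R : realType) (B : bratteli).

(** A single countable index set for all vertices, so that functions on it form
    an ordinary product space. *)
Definition pvertex := {n : nat & vertex B n}.
Implicit Types (u : pvertex -> R) (A : set (bpath B)).

Definition at_level n (v : vertex B n) : pvertex := Tagged (vertex B) v.

(** The integral of [f] at the end vertex over the paths of length [n] that lie
    in [A]. Membership is tested at a representative, which makes this additive
    in [A] for all sets [A]; it is meaningful for [A] determined at level
    [n]. *)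
Definition path_sum n (f : vertex B n -> R) A : R :=
  \sum_(p : edge_seq B n | `[< is_fpath p >] && (extension p \in A))
    f (end_vertex p).

(** A path of length [n.+1] is a path of length [n] followed by an edge, and the
    last edge does not affect membership in [A]. *)
Lemma path_sumS n (f : vertex B n.+1 -> R) A : determined n A ->
  path_sum f A =
  path_sum (fun v => \sum_(e : edge B n | src e == v) f (rng e)) A.
Proof.
move=> dA; rewrite /path_sum.
rewrite (reindex (fun qe : edge_seq B n * edge B n => append qe.1 qe.2));
  last first.
  exists (fun r => (init r, r ord_max)) => [[q e] _|r _] /=.
    by rewrite appendK append_last.
  exact: initK.
rewrite pair_big_dep /=; apply: eq_big => [[q e]|[q e] _] /=; last first.
  by rewrite append_last.
apply/idP/idP => [/andP[/asboolP fqe /set_mem Aqe]|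
    /andP[/andP[/asboolP fq /set_mem Aq] /eqP se]].
  have [fq se] := (is_fpath_append q e).1 fqe.
  rewrite asboolT//= se eqxx andbT; apply/mem_set; apply: dA Aqe.
  by rewrite -init_truncate !extensionK// appendK.
have fqe : is_fpath (append q e) by apply/is_fpath_append.
rewrite asboolT//=; apply/mem_set; apply: dA Aq.
by rewrite -[RHS]init_truncate !extensionK// appendK.
Qed.

Lemma path_sum_cylinder n (f : vertex B n -> R) (p : edge_seq B n) :
  is_fpath p -> path_sum f (cylinder p) = f (end_vertex p).
Proof.
move=> fp; rewrite /path_sum (bigD1 p) /=; last first.
  by rewrite asboolT//=; apply/mem_set/cylinder_extension.
rewrite big1 ?addr0// => q /andP[/andP[/asboolP fq /set_mem]].
by rewrite cylinderE /= extensionK// => ->; rewrite eqxx.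
Qed.

Definition mass u n A : R := path_sum (fun v : vertex B n => u (at_level v)) A.

Definition harmonic_at u n := forall v : vertex B n,
  u (at_level v) = \sum_(e : edge B n | src e == v) u (at_level (rng e)).

Lemma massS u n A : harmonic_at u n -> determined n A ->
  mass u n.+1 A = mass u n A.
Proof.
by move=> hu dA; rewrite /mass path_sumS//; apply: eq_bigr => p _; rewrite hu.
Qed.

Lemma mass_stable u m n A : determined m A -> (m <= n)%N ->
  (forall k, (k < n)%N -> harmonic_at u k) -> mass u n A = mass u m A.
Proof.
move=> dA; elim: n => [|n IHn]; first by rewrite leqn0 => /eqP->.
rewrite leq_eqVlt => /orP[/eqP<-//|le_mn] harm.
rewrite massS; [|exact: harm|exact: determined_le dA].
by apply: IHn => // k lt_kn; apply: harm; rewrite ltnW.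
Qed.

Lemma mass_root u : mass u 0 setT = u (at_level (root_vertex B)).
Proof.
rewrite /mass /path_sum (big_pred1 (truncate 0 (point : bpath B))) => [|p].
  by rewrite end_truncate (root_unique (src _)).
by rewrite /= asboolT//= mem_setT; apply/esym/eqP/edge_seq0.
Qed.

Lemma mass_cylinder u n (p : edge_seq B n) : is_fpath p ->
  mass u n (cylinder p) = u (at_level (end_vertex p)).
Proof. exact: path_sum_cylinder. Qed.

Lemma mass_le u n A A' : (forall i, 0 <= u i) -> A `<=` A' ->
  mass u n A <= mass u n A'.
Proof.
move=> u_ge0 sAA'; rewrite /mass /path_sum [leLHS]big_mkcond [leRHS]big_mkcond.
apply: ler_sum => p _ /=; case: asboolP => //= _.
case: ifPn => [/set_mem/sAA'/mem_set ->//|_]; by case: ifP.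
Qed.

Lemma massU u n A A' : A `&` A' = set0 ->
  mass u n (A `|` A') = mass u n A + mass u n A'.
Proof.
move=> AA'0; rewrite /mass /path_sum [LHS]big_mkcond.
rewrite [X in X + _]big_mkcond [X in _ + X]big_mkcond -big_split /=.
apply: eq_bigr => p _; case: asboolP => _ /=; last by rewrite addr0.
rewrite in_setU; have [Ap|nAp] := boolP (_ \in A);
  have [A'p|nA'p] := boolP (_ \in A');
  rewrite ?addr0 ?add0r//.
have : (A `&` A') (extension p) by split; exact: set_mem.
by rewrite AA'0.
Qed.

Lemma mass0 u n : mass u n set0 = 0.
Proof. by rewrite /mass /path_sum big1// => p; rewrite in_set0 andbF. Qed.

Lemma mass_ge0 u n A : (forall i, 0 <= u i) -> 0 <= mass u n A.
Proof. by move=> u_ge0; apply: sumr_ge0. Qed.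

Lemma mass_setT u n :
  mass u n setT = \sum_(w : vertex B n) (height w)%:R * u (at_level w).
Proof.
rewrite /mass /path_sum (partition_big (@end_vertex B n) xpredT)//=.
apply: eq_bigr => w _.
rewrite (eq_bigr (fun=> u (at_level w))); last by move=> p /andP[_ /eqP->].
rewrite sumr_const mulr_natl /height; congr (_ *+ _).
by apply: eq_card => p; rewrite inE [LHS]unfold_in in_setT andbT.
Qed.

Variable S : vertex_subdiagram B.

Definition stay n : set (bpath B) :=
  [set x | forall i, (i < n)%N -> induced_edge (vset S) (x i)].

Lemma determined_stay n : determined n (stay n).
Proof. by move=> x y /eq_truncateP exy sx i lt_i; rewrite -exy// sx. Qed.

Lemma stay_le m n : (m <= n)%N -> stay n `<=` stay m.
Proof. by move=> le_mn x sx i lt_i; apply: sx; exact: leq_trans le_mn. Qed.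

Lemma sub_bpathsE : sub_bpaths S = \bigcap_n stay n.
Proof.
apply/seteqP; split=> [x Sx n _ i _|x sx n]; first exact: Sx.
exact: (sx n.+1).
Qed.

Lemma mass_stay u n :
  mass u n (stay n) =
  \sum_(w : vertex B n) (sub_height S w)%:R * u (at_level w).
Proof.
rewrite /mass /path_sum (partition_big (@end_vertex B n) xpredT)//=.
apply: eq_bigr => w _.
rewrite (eq_bigr (fun=> u (at_level w))); last by move=> p /andP[_ /eqP->].
rewrite sumr_const mulr_natl /sub_height; congr (_ *+ _).
apply: eq_card => p; rewrite inE [LHS]unfold_in inE andbAC.
case: asboolP => //= fp; congr andb.
have [x -> _] := fpath_truncate fp.
apply/idP/forallP => [/set_mem Ap i|Ap].
  rewrite ffunE.
  by have /= sx := (extension_truncate x (@determined_stay n)).1 Ap; exact: sx.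
apply/mem_set/(extension_truncate _ (@determined_stay n)) => i lt_i.
by have := Ap (Ordinal lt_i); rewrite ffunE.
Qed.

Lemma mass_stayS u n : (forall i, 0 <= u i) -> harmonic_at u n ->
  mass u n.+1 (stay n.+1) <= mass u n (stay n).
Proof.
move=> u0 harm; rewrite -(massS harm (@determined_stay n)).
by apply: mass_le => //; exact: stay_le.
Qed.

Lemma sub_height_notin n (w : vertex B n.+1) :
  w \notin vset S n.+1 -> sub_height S w = 0%N.
Proof.
move=> nSw; apply: eq_card0 => p; rewrite !inE.
apply/negP => /andP[/andP[_ /eqP endp] /forallP/(_ ord_max)/andP[_ Sw]].
by rewrite -endp Sw in nSw.
Qed.

Lemma height_gt0 n (w : vertex B n) : (0 < height w)%N.
Proof.
by have [p wp] := paths_toP w; rewrite card_gt0; apply/set0Pn; exists p.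
Qed.

End Mass.

(** * Measures from vertex weights *)

(** The path space with the algebra of sets depending on finitely many edges,
    rather than with its Borel sets. *)
Definition stage_bpath (B : bratteli) := bpath B.

HB.instance Definition _ (B : bratteli) := Pointed.on (stage_bpath B).
HB.instance Definition _ (B : bratteli) :=
  @isAlgebraOfSets.Build default_measure_display (stage_bpath B)
    (@finite_stage B) (@finite_stage0 B) (@finite_stageU B) (@finite_stageC B).

(** The measure structure on [pushforward m f] depends on a proof that [f] is
    measurable, which unification cannot guess; here it is an argument. *)
Definition image_measure d d' (T1 : measurableType d) (T2 : measurableType d')
    (R : realType) (m : {measure set T1 -> \bar R}) (f : T1 -> T2)
    (mf : measurable_fun setT f) : {measure set T2 -> \bar R} :=
  measure_function_pushforward__canonical__measure_function_Measure m mf.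

Section Extension.
Variables (R : realType) (B : bratteli).
Implicit Types (A : set (bpath B)).

Definition weight (u : pvertex B -> R) :=
  [/\ forall i, 0 <= u i, u (at_level (root_vertex B)) = 1 &
      forall n, harmonic_at u n].

Variables (u : pvertex B -> R) (hu : weight u).

Lemma weight_total n : mass u n setT = 1.
Proof.
have [_ u1 harm] := hu.
by rewrite (@mass_stable _ _ _ 0)// mass_root.
Qed.

Hypothesis compactB : compact [set: bpath B].

(** [mass u n A] is the same for all [n] at which [A] is determined, so any
    chosen such level will do. *)
Definition stage_measure (A : set (stage_bpath B)) : \bar R :=
  (mass u (get [set n | determined n A]) A)%:E.

Lemma stage_measureE n A : determined n A -> stage_measure A = (mass u n A)%:E.
Proof.
have [_ _ harm] := hu => dA.
have dgA : determined (get [set n | determined n A]) A.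
  exact: (@getPex _ [set n | determined n A] (ex_intro _ n dA)).
rewrite /stage_measure; congr EFin.
set m := get _ in dgA *.
rewrite -(mass_stable dA (leq_maxr m n) (fun k _ => harm k)).
by rewrite -(mass_stable dgA (leq_maxl m n) (fun k _ => harm k)).
Qed.

Let stage_measure0 : stage_measure set0 = 0%E.
Proof. by rewrite (@stage_measureE 0)// mass0. Qed.

Let stage_measure_ge0 A : (0 <= stage_measure A)%E.
Proof. by rewrite lee_fin mass_ge0//; case: hu. Qed.

(** A disjoint sequence of open sets with compact union has only finitely many
    nonempty members, so finite additivity suffices. *)
Let stage_measure_sigma_additive : semi_sigma_additive stage_measure.
Proof.
have add : measure_function.additive stage_measure.
  rewrite -semi_additiveE; apply/additive2P => // A A' [m dA] [n dA'] AA'0.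
  have {}dA := determined_le (leq_maxl m n) dA.
  have {}dA' := determined_le (leq_maxr m n) dA'.
  by rewrite (stage_measureE (determinedU dA dA')) (stage_measureE dA)
    (stage_measureE dA') massU.
move=> F mF tF mUF.
have oF i : open (F i : set (bpath B)) by exact/open_finite_stage/(mF i).
have cF : compact (\bigcup_n F n : set (bpath B)).
  rewrite -[X in compact X]setTI; apply: compact_closedI => //.
  by rewrite -openC; exact/open_finite_stage/finite_stageC/mUF.
move: cF; rewrite compact_cover.
move=> /(_ nat setT F (fun i _ => oF i) (@subset_refl _ _)).
move=> [D _ FD]; pose N := \max_(i <- finmap.enum_fset D) i.+1.
have F0 i : (N <= i)%N -> F i = set0.
  move=> le_Ni; apply/seteqP; split=> // x Fx.
  have [j /= Dj Fjx] := FD x (ex_intro2 _ _ i I Fx).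
  have eij : i = j by apply: tF => //; exists x.
  have : (i < N)%N.
    by rewrite eij; exact: (leq_bigmax_seq (F := fun i => i.+1) j).
  by rewrite ltnNge le_Ni.
apply: cvg_near_cst; exists N => // k /= le_Nk.
transitivity (stage_measure (\big[setU/set0]_(i < k) F i)).
  by rewrite big_mkord add.
congr stage_measure; rewrite -bigcup_mkord.
apply/seteqP; split=> x [i _ Fx]; exists i => //=.
rewrite ltnNge; apply/negP => le_ki.
by move: Fx; rewrite F0// (leq_trans le_Nk).
Qed.

HB.instance Definition _ := isMeasure.Build _ _ _ stage_measure
  stage_measure0 stage_measure_ge0 stage_measure_sigma_additive.

(** Caratheodory's extension lives on the sigma-algebra generated by the sets
    of finite stage; its image under the identity is a Borel measure. *)
Lemma weight_measure : exists mu : probability (borel_bpath B) R,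
  forall n (p : edge_seq B n), is_fpath p ->
    mu (cylinder p) = (u (at_level (end_vertex p)))%:E.
Proof.
pose stageM := @measurable _ (stage_bpath B).
pose nu : {measure set (g_sigma_algebraType stageM) -> \bar R} :=
  measure_extension stage_measure.
have nuE n A : determined n A -> nu A = (mass u n A)%:E.
  move=> dA; rewrite -(stage_measureE dA); apply: measurable_mu_extE.
  by exists n.
have mid : measurable_fun setT
    (id : g_sigma_algebraType stageM -> borel_bpath B).
  move=> _ A mA; rewrite setTI preimage_id.
  have : <<s @finite_stage B >> A by rewrite -borel_finite_stage.
  exact.
have [mu muE] : exists mu : {measure set (borel_bpath B) -> \bar R},
    forall A, mu A = nu A.
  by exists (image_measure nu mid).
have mu1 : mu setT = 1%E by rewrite muE (@nuE 0)// weight_total.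
(* [mu] has total mass 1, so normalising only adds the probability structure *)
exists (mnormalize mu (point : probability (borel_bpath B) R)) => n p fp.
rewrite [LHS](_ : _ = mu (cylinder p)).
  by rewrite muE (@nuE n) ?mass_cylinder//; exact: determined_cylinder.
by rewrite /= /mnormalize mu1 onee_eq0/= invr1 mule1.
Qed.

End Extension.

(** * Tail-invariant measures *)

Section Rerouting.
Variable B : bratteli.

(** Replaces the first [n] edges of [x] by [q] if this gives a path, and leaves
    [x] alone otherwise, so as to be a total map that moves every point within
    its tail class. *)
Definition reroute n (q : edge_seq B n) (fq : is_fpath q) (x : bpath B) :
    bpath B :=
  if pselect (end_vertex q = src (x n)) is left endq
  then BPath (splice_bpathP fq endq) else x.

Variables (n : nat) (q : edge_seq B n) (fq : is_fpath q).

Lemma rerouteE (x : bpath B) : end_vertex q = src (x n) ->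
  reroute fq x = splice q x :> (forall i, edge B i).
Proof. by rewrite /reroute; case: pselect. Qed.

Lemma cylinder_reroute (x : bpath B) :
  end_vertex q = src (x n) -> cylinder q (reroute fq x).
Proof. by move=> endq i; rewrite rerouteE// splice_ord. Qed.

Lemma tail_equivalent_reroute (x : bpath B) : tail_equivalent (reroute fq x) x.
Proof.
exists n => i le_ni; rewrite /reroute; case: pselect => //= endq.
by rewrite splice_ge.
Qed.

Lemma measurable_reroute :
  measurable_fun setT (reroute fq : borel_bpath B -> borel_bpath B).
Proof.
apply: (@measurability _ _ (borel_bpath B) (borel_bpath B) _ _
  (@finite_stage B)); first exact: borel_finite_stage.
move=> _ [A [m dA] <-]; rewrite setTI; apply: measurable_finite_stage.
(* edge n, the first one after q, decides whether x is rerouted at all *)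
exists (maxn m n.+1) => x y exy; apply: dA.
have exyn : truncate n.+1 x = truncate n.+1 y.
  exact: eq_truncate_le (leq_maxr _ _) exy.
have [ex ey] : end_vertex q = src (x n) <-> end_vertex q = src (y n).
  by rewrite ((eq_truncateP _ _ _).1 exyn n).
apply/eq_truncateP => i lt_i.
have exyi : x i = y i.
  by apply: (eq_truncateP _ _ _).1 exy _ _; rewrite leq_max lt_i.
have [endq|nendq] := pselect (end_vertex q = src (x n)).
  rewrite !rerouteE//; last exact: ex.
  have [lt_in|le_ni] := ltnP i n; first by rewrite !(splice_lt _ _ lt_in).
  by rewrite !splice_ge.
rewrite /reroute; case: pselect => // nx; case: pselect => // /ey//.
Qed.

End Rerouting.

Section TailInvariant.
Variables (R : realType) (B : bratteli) (mu : probability (borel_bpath B) R).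
Hypothesis mu_inv : tail_invariant mu.

Lemma paths_to_end n (p : edge_seq B n) w :
  (p \in paths_to w) <-> is_fpath p /\ end_vertex p = w.
Proof.
rewrite inE; split=> [/andP[/asboolP ? /eqP]|[fp <-]]//.
by rewrite asboolT ?eqxx.
Qed.

Lemma cylinder_invariant n (p q : edge_seq B n) : is_fpath p -> is_fpath q ->
  end_vertex p = end_vertex q -> mu (cylinder p) = mu (cylinder q).
Proof.
by move=> fp fq epq; apply: mu_inv (end_vertex q) _ _ _ _; apply/paths_to_end.
Qed.

Lemma truncate_invariant n (x y : bpath B) : x n = y n ->
  mu (cylinder (truncate n.+1 x)) = mu (cylinder (truncate n.+1 y)).
Proof.
move=> exy; apply: cylinder_invariant; rewrite ?end_truncate -?bpathP ?exy//;
  exact: is_fpath_truncate.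
Qed.

(** Both sides are finite measures in [A], so it suffices to compare them on the
    cylinder of a path [r] longer than [p] and [q]. If [r] begins with [q], the
    left side is the cylinder of [r] with its beginning replaced by [p], which
    ends at the same vertex; otherwise both sides are empty. *)
Lemma reroute_invariant n (p q : edge_seq B n) (fq : is_fpath q) A :
  is_fpath p -> end_vertex p = end_vertex q ->
  @measurable _ (borel_bpath B) A ->
  mu (reroute fq @^-1` A `&` cylinder p) = mu (A `&` cylinder q).
Proof.
move=> fp epq mA.
pose nu1 : {measure set (borel_bpath B) -> \bar R} :=
  image_measure (mrestr mu (measurable_cylinder p)) (measurable_reroute fq).
pose nu2 : {measure set (borel_bpath B) -> \bar R} :=
  mrestr mu (measurable_cylinder q).
apply: (@eq_measure_cylinder B R n.+1 nu1 nu2) => //.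
  rewrite /nu1 /= /pushforward /mrestr.
  rewrite (le_lt_trans (probability_le1 _ _))// ?ltry//.
  by rewrite preimage_setT setTI; exact: measurable_cylinder.
move=> [//|m] r lt_nm fr.
rewrite /nu1 /nu2 /= /pushforward /mrestr.
have src_p z : cylinder p z -> end_vertex q = src (z n).
  by rewrite cylinderE /= -epq => <-; rewrite end_truncate.
have src_q z : cylinder q z -> end_vertex p = src (z n).
  by rewrite cylinderE /= epq => <-; rewrite end_truncate.
have [x def_r endr] := fpath_truncate fr.
have [qx|nqx] := pselect (cylinder q x); last first.
  rewrite [X in mu X](_ : _ = set0); last first.
    apply/seteqP; split=> // z [/= rz pz]; apply: nqx.
    apply: (determined_cylinder _ (cylinder_reroute fq (src_p z pz))).
    apply: eq_truncate_le (ltnW lt_nm) _.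
    by move: rz; rewrite cylinderE /= def_r.
  rewrite [X in _ = mu X](_ : _ = set0)//.
  apply/seteqP; split=> // z [/= rz qz]; apply: nqx.
  apply: determined_cylinder qz; apply: eq_truncate_le (ltnW lt_nm) _.
  by move: rz; rewrite cylinderE /= def_r.
pose y := reroute fp x.
have yE : y = splice p x :> (forall i, edge B i).
  by apply: rerouteE; exact: src_q.
rewrite [X in mu X](_ : _ = cylinder (truncate m.+1 y)); last first.
  apply/seteqP; split=> z.
    move=> [/= + pz]; rewrite def_r !cylinderE /= => /eq_truncateP rz.
    apply/eq_truncateP => i lt_i; rewrite yE.
    have [lt_in|le_ni] := ltnP i n.
      by rewrite (splice_lt _ _ lt_in) -(pz (Ordinal lt_in)).
    rewrite splice_ge// -rz// rerouteE ?splice_ge//; exact: src_p.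
  rewrite cylinderE /= => /eq_truncateP zy.
  have pz : cylinder p z.
    move=> i; rewrite zy; last by rewrite (leq_trans (ltn_ord i))// ltnW.
    by rewrite yE splice_ord.
  split=> //; rewrite /= def_r cylinderE /=; apply/eq_truncateP => i lt_i.
  rewrite rerouteE; last exact: src_p.
  have [lt_in|le_ni] := ltnP i n.
    by rewrite (splice_lt _ _ lt_in) -(qx (Ordinal lt_in)).
  by rewrite splice_ge// zy// yE splice_ge.
rewrite setIidl; last first.
  move=> z; rewrite def_r cylinderE /= => zx.
  apply: determined_cylinder qx; apply: eq_truncate_le (ltnW lt_nm) _.
  exact/esym.
by rewrite def_r; apply: truncate_invariant; rewrite yE splice_ge.
Qed.

Definition tail_closed (A : set (bpath B)) :=
  forall x y, tail_equivalent x y -> A x -> A y.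

(** Rerouting stays within tail classes, so it preserves [A] while carrying one
    cylinder onto the other. *)
Lemma tail_closed_invariant A n (p q : edge_seq B n) :
  @measurable _ (borel_bpath B) A -> tail_closed A ->
  is_fpath p -> is_fpath q -> end_vertex p = end_vertex q ->
  mu (cylinder p `&` A) = mu (cylinder q `&` A).
Proof.
move=> mA tA fp fq epq; rewrite ![cylinder _ `&` _]setIC.
rewrite -(reroute_invariant fq fp epq mA).
congr (mu (_ `&` _)); apply/seteqP; split=> x /=; apply: tA.
  have [N xN] := tail_equivalent_reroute fq x.
  by exists N => i /xN.
exact: tail_equivalent_reroute.
Qed.

(** By invariance the choice of the path to the vertex is immaterial. *)
Definition weight_of (i : pvertex B) : R :=
  fine (mu (cylinder (projT1 (cid (paths_toP (tagged i)))))).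

Lemma weight_ofE n (p : edge_seq B n) : is_fpath p ->
  mu (cylinder p) = (weight_of (at_level (end_vertex p)))%:E.
Proof.
move=> fp; rewrite /weight_of; case: cid => q /= /paths_to_end[fq eq].
rewrite fineK ?fin_num_measure//; last exact: measurable_cylinder.
exact: cylinder_invariant.
Qed.

Lemma measure_mass n A : determined n A -> mu A = (mass weight_of n A)%:E.
Proof.
move=> dA; rewrite (measure_determined _ dA) /mass /path_sum -sumEFin.
by apply: eq_bigr => p /andP[/asboolP fp _]; exact: weight_ofE.
Qed.

Lemma weight_weight_of : weight weight_of.
Proof.
split=> [i||n v].
- by rewrite fine_ge0.
- have [p /paths_to_end[fp endp]] := paths_toP (root_vertex B).
  apply: EFin_inj; rewrite -endp -weight_ofE// -(probability_setT mu).
  congr (mu _).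
  by apply/seteqP; split=> // x _ [].
have [p /paths_to_end[fp endp]] := paths_toP v.
have dp := @determined_cylinder B n p.
have := measure_mass dp; rewrite (measure_mass (determined_le (leqnSn n) dp)).
move=> [/esym]; rewrite {1}/mass path_sum_cylinder// endp => ->.
by rewrite /mass path_sumS// path_sum_cylinder// endp.
Qed.

End TailInvariant.

(** * Extreme points by iterated maximisation *)

Section Extreme.
Variables (R : realType) (T : topologicalType).
Implicit Types (F : set T) (g : T -> R).

Lemma nested_compact (I : Type) (D : set I) F (E : I -> set T) :
  compact F -> (exists i, D i) ->
  (forall i, D i -> [/\ closed (E i), E i `<=` F & E i !=set0]) ->
  (forall i j, D i -> D j -> exists2 k, D k & E k `<=` E i `&` E j) ->
  exists x, forall i, D i -> E i x.
Proof.
move=> cF [i0 Di0] EP Edir.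
have FF : ProperFilter (filter_from D E).
  apply: filter_from_proper; last by move=> i /EP[].
  by apply: filter_from_filter => //; exists i0.
have [|x [_ xE]] := cF _ FF.
  by exists i0 => //; have [] := EP _ Di0.
exists x => i Di; have [cE _ _] := EP _ Di.
by apply: cE; move: xE; rewrite clusterE; apply; exists i.
Qed.

Definition argmax F g : set T := [set x | F x /\ forall y, F y -> g y <= g x].

(** For closed [F] this is upper semicontinuity of the restriction of [g] to
    [F]. The restriction matters for the infimum of the masses of the paths in
    the subdiagram, which has the expected meaning on weights only. *)
Definition usc_on F g := forall c, closed (F `&` [set x | c <= g x]).

(** The superlevel sets of [g] at its own values form a chain of nonempty
    compact sets, and a common point of them is a maximiser. *)
Lemma argmaxP F g : compact F -> F !=set0 -> usc_on F g ->
  closed (argmax F g) /\ argmax F g !=set0.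
Proof.
move=> cF [x0 Fx0] usc; split.
  have -> : argmax F g = \bigcap_(y in F) (F `&` [set x | g y <= g x]).
    apply/seteqP; split=> [x [Fx gx] y Fy|x xF].
      by split=> //=; exact: gx.
    by split=> [|y Fy]; [have [] := xF _ Fx0 | have [] := xF _ Fy].
  by apply: closed_bigI => y _; exact: usc.
have [|y Fy|i j Fi Fj|x xF] :=
  @nested_compact T F F (fun y => F `&` [set x | g y <= g x]) cF.
- by exists x0.
- by split; [exact: usc | exact: subIsetl | exists y; split=> /=].
- have [le_ij|/ltW le_ji] := leP (g i) (g j).
    by exists j => // z [Fz /= le_jz]; do !split=> //=; exact: le_trans le_jz.
  by exists i => // z [Fz /= le_iz]; do !split=> //=; exact: le_trans le_iz.
exists x; split=> [|y Fy]; first by have [] := xF _ Fx0.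
by have [] := xF _ Fy.
Qed.

(** Maximise [f 0] on [F], then [f 1] among the maximisers, and so on; a point
    [x] common to all stages exists by compactness. If [x] is a convex
    combination of [a] and [b] as far as the [f k] can see, then by induction
    [a] and [b] survive every stage: neither exceeds the maximum [f k x] of its
    stage, and a mean of two numbers attains such a bound only if both do. *)
Lemma extreme_point F (f : nat -> T -> R) :
  compact F -> closed F -> F !=set0 -> (forall k, usc_on F (f k)) ->
  exists x, [/\ F x, forall y, F y -> f 0%N y <= f 0%N x &
    forall (t : R) a b, 0 < t < 1 -> F a -> F b ->
      (forall k, f k x = t * f k a + (1 - t) * f k b) ->
      forall k, f k a = f k x].
Proof.
move=> cF clF F0 usc.
pose E := fix E k := if k is k'.+1 then argmax (E k') (f k') else F.
have EF k : E k `<=` F by elim: k => // k IHk x [/IHk].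
have EP k : closed (E k) /\ E k !=set0.
  elim: k => [|k [clE E0]] //=; apply: argmaxP => // [|c].
    exact: subclosed_compact clE cF (EF k).
  rewrite -(setIidl (EF k)) -setIA; apply: closedI => //; exact: usc.
have Ele m n : (m <= n)%N -> E n `<=` E m.
  elim: n => [|n IHn]; first by rewrite leqn0 => /eqP->.
  by rewrite leq_eqVlt => /orP[/eqP->//|/IHn sE x [/sE]].
have [|k _|m n _ _|x xE] := @nested_compact nat setT F E cF.
- by exists 0%N.
- by have [? ?] := EP k; split.
- exists (maxn m n) => // y Ey.
  by split; apply: Ele Ey; rewrite ?leq_maxl ?leq_maxr.
have xmax k y : E k y -> f k y <= f k x by have [_] := xE k.+1 I; apply.
exists x; split; [exact: (xE 0%N) | exact: (xmax 0%N) |].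
move=> t a b /andP[t0 t1] Fa Fb fx.
have t1' : 0 < 1 - t by rewrite subr_gt0.
have fab k : E k a -> E k b -> f k a = f k x /\ f k b = f k x.
  move=> /xmax fa /xmax fb; have := fx k; split; nra.
have Eab k : E k a /\ E k b.
  elim: k => // k [Ea Eb]; have [fa fb] := fab k Ea Eb.
  by split; split=> // y /xmax; rewrite ?fa ?fb.
by move=> k; have [Ea Eb] := Eab k; have [] := fab k Ea Eb.
Qed.

End Extreme.

(** * The compact space of weights *)

Section BackwardWeight.
Variables (R : realType) (B : bratteli).

(** The harmonic equations determine the lower levels from the values [g] at
    level [n]. Above level [n] the zero function keeps the result bounded. *)
Lemma backward_weight n (g : vertex B n -> R) : (forall v, 0 <= g v) ->
  exists c : pvertex B -> R, [/\ forall i, 0 <= c i,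
    forall v, c (at_level v) = g v,
    forall k, (k < n)%N -> harmonic_at c k &
    forall k (v : vertex B k), (n < k)%N -> c (at_level v) = 0].
Proof.
elim: n g => [|n IHn] g g0.
  pose c (i : pvertex B) : R :=
    dfwith (fun k (_ : vertex B k) => 0 : R) 0%N g (tag i) (tagged i).
  exists c; split=> // [[k]|v|k v k0].
  - by rewrite /c /=; case: dfwithP.
  - by rewrite /c /= dfwithin.
  - by rewrite /c /= dfwithout// ltn_eqF.
have [|c' [c'0 c'g harm c'out]] :=
    IHn (fun v => \sum_(e : edge B n | src e == v) g (rng e)).
  by move=> v; exact: sumr_ge0.
pose c (i : pvertex B) : R :=
  dfwith (fun k (v : vertex B k) => c' (at_level v)) n.+1 g (tag i) (tagged i).
have cE k (v : vertex B k) : n.+1 != k -> c (at_level v) = c' (at_level v).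
  by move=> nk; rewrite /c /= dfwithout.
have cg v : c (at_level v) = g v by rewrite /c /= dfwithin.
exists c; split=> // [[k]|k lt_kn v|k v lt_nk].
- by rewrite /c /=; case: dfwithP => // j _ v; exact: c'0.
- rewrite cE; last by rewrite gtn_eqF.
  move: lt_kn; rewrite ltnS leq_eqVlt => /orP[/eqP eq_kn|lt_kn].
    by subst k; rewrite c'g; apply: eq_bigr => e _; rewrite cg.
  rewrite harm//; apply: eq_bigr => e _; rewrite cE//.
  by rewrite eqSS gtn_eqF.
- by rewrite cE ?ltn_eqF// c'out// ltnW.
Qed.

End BackwardWeight.

Section WeightSpace.
Variables (R : realType) (B : bratteli).

Definition weight_space : topologicalType :=
  prod_topology (fun _ : pvertex B => R).

Lemma continuous_path_sum n (h : vertex B n -> weight_space -> R) A :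
  (forall v, continuous (h v)) -> continuous (fun u => path_sum (h^~ u) A).
Proof.
by move=> ch; apply: (continuous_big (@add_continuous R)) => p _; exact: ch.
Qed.

Lemma continuous_coordinate i : continuous (fun u : weight_space => u i).
Proof. exact: (@proj_continuous (pvertex B) (fun=> R) i). Qed.

Lemma continuous_mass n A : continuous (fun u : weight_space => mass u n A).
Proof. by apply: continuous_path_sum => v; exact: continuous_coordinate. Qed.

Lemma closed_superlevel (g : weight_space -> R) c :
  continuous g -> closed [set u | c <= g u].
Proof.
by move=> cg; apply: (preimage_closed _ (@closed_ge R c)) => u _; exact: cg.
Qed.

Lemma closed_level (g : weight_space -> R) c :
  continuous g -> closed [set u | g u = c].
Proof.
by move=> cg; apply: (preimage_closed _ (@closed_eq R c)) => u _; exact: cg.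
Qed.

Definition defect n (v : vertex B n) (u : weight_space) : R :=
  u (at_level v) - \sum_(e : edge B n | src e == v) u (at_level (rng e)).

Lemma continuous_defect n (v : vertex B n) : continuous (defect v).
Proof.
pose f (u : weight_space) : R := u (at_level v).
pose g (u : weight_space) : R :=
  \sum_(e : edge B n | src e == v) u (at_level (rng e)).
have cf : continuous f by exact: continuous_coordinate.
have cg : continuous g.
  apply: (continuous_big (@add_continuous R)) => e _.
  exact: continuous_coordinate.
have -> : defect v = f - g by apply/funext.
by move=> u; apply: continuousB; [exact: cf | exact: cg].
Qed.

Lemma harmonic_defect (u : weight_space) n :
  harmonic_at u n <-> forall v : vertex B n, defect v u = 0.
Proof.
split=> h v; first by rewrite /defect h subrr.
by apply/eqP; rewrite -subr_eq0; apply/eqP; exact: h.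
Qed.

Definition weights : set weight_space := [set u | weight u].

Lemma closed_weights : closed weights.
Proof.
have -> : weights = \bigcap_i [set u | 0 <= u i] `&`
    [set u | u (at_level (root_vertex B)) = 1] `&`
    \bigcap_n \bigcap_(v : vertex B n) [set u | defect v u = 0].
  apply/seteqP; split=> u.
    move=> [u0 u1 harm]; split; [split=> [i _|]|move=> n _ v _] => /=.
    - exact: u0.
    - exact: u1.
    - exact: (harmonic_defect u n).1 (harm n) v.
  move=> [[u0 u1] harm]; split=> //.
    by move=> i; exact: u0.
  by move=> n; apply/harmonic_defect => v; exact: harm.
apply: closedI; first apply: closedI.
- apply: closed_bigI => i _; apply: closed_superlevel.
  exact: continuous_coordinate.
- by apply: closed_level; exact: continuous_coordinate.
- apply: closed_bigI => n _; apply: closed_bigI => v _; apply: closed_level.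
  exact: continuous_defect.
Qed.

Definition unit_box : set weight_space :=
  [set u | forall i, `[0, 1]%classic (u i)].

Lemma compact_unit_box : compact unit_box.
Proof.
apply: (@tychonoff _ (fun _ : pvertex B => R) (fun=> `[0, 1]%classic)) => i.
exact: segment_compact.
Qed.

(** One path ends at [v], so [u v] is a summand of the total mass. *)
Lemma mass_le1 (u : weight_space) n (v : vertex B n) : (forall i, 0 <= u i) ->
  mass u n setT = 1 -> u (at_level v) <= 1.
Proof.
move=> u0; rewrite mass_setT (bigD1 v) //= => total1.
have h1 : 1 <= (height v)%:R :> R by rewrite ler1n height_gt0.
apply: (@le_trans _ _ ((height v)%:R * u (at_level v))).
  by rewrite ler_peMl.
rewrite -[leRHS]total1 lerDl; apply: sumr_ge0 => w _.
by rewrite mulr_ge0.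
Qed.

Lemma weights_box : weights `<=` unit_box.
Proof.
move=> u hu [n v]; have [u0 _ _] := hu.
rewrite /= in_itv /= u0 /=; apply: mass_le1 => //; exact: weight_total.
Qed.

Lemma compact_weights : compact weights.
Proof.
exact: subclosed_compact closed_weights compact_unit_box weights_box.
Qed.

Variable S : vertex_subdiagram B.

(** Start backwards from the normalised indicator of a vertex [w] of level [n.+1]
    with ratio at least [eps]: this gives the proportion of the paths to [w]
    that pass through a given vertex, divided by the height of that vertex. Then
    let [n] grow; each condition on a weight involves finitely many coordinates
    and is closed, so it passes to a cluster point. *)
Lemma exists_weight (eps : R) :
  (forall n, (0 < n)%N -> exists2 w : vertex B n, w \in vset S n &
     eps <= (sub_height S w)%:R / (height w)%:R) ->
  exists2 u : weight_space, weight u & forall n, eps <= mass u n (stay S n).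
Proof.
move=> hS.
(* such vertices are given at positive levels, whence the shift to n.+1 *)
have approx n : exists c : weight_space, [/\ unit_box c,
    forall i, 0 <= c i, c (at_level (root_vertex B)) = 1,
    forall k, (k < n.+1)%N -> harmonic_at c k &
    forall k, (k <= n.+1)%N -> eps <= mass c k (stay S k)].
  have [w _ wS] := hS n.+1 isT.
  have hw0 : (height w)%:R != 0 :> R by rewrite pnatr_eq0 -lt0n height_gt0.
  pose g v : R := (v == w)%:R / (height w)%:R.
  have [v|c [c0 cg harm cout]] := @backward_weight R B n.+1 g.
    by rewrite divr_ge0.
  have sum_g (a : vertex B n.+1 -> R) :
      \sum_v a v * c (at_level v) = a w / (height w)%:R.
    rewrite (bigD1 w)//= big1 => [|v /negPf vw];
      rewrite cg /g ?vw ?mul0r ?mulr0//.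
    by rewrite eqxx mul1r addr0.
  have total k : (k <= n.+1)%N -> mass c k setT = 1.
    move=> le_k; transitivity (mass c n.+1 setT).
      by apply/esym/mass_stable => // x y _.
    by rewrite mass_setT sum_g divff.
  exists c; split=> //.
  - move=> [k v]; rewrite /= in_itv /= c0 /=.
    have [le_k|lt_k] := leqP k n.+1.
      by apply: mass_le1 => //; exact: total.
    by rewrite (cout _ v lt_k).
  - by rewrite -mass_root total.
  - move=> k le_k; apply: (@le_trans _ _ (mass c n.+1 (stay S n.+1))).
      by rewrite mass_stay sum_g.
    rewrite -(subnK le_k); move: (n.+1 - k)%N (subnK le_k) => d.
    elim: d k {le_k} => [|d IHd] k dk; first by rewrite add0n.
    apply: (@le_trans _ _ (mass c k.+1 (stay S k.+1))).
      by rewrite addSnnS; apply: IHd; rewrite -dk addSnnS.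
    apply: mass_stayS => //; apply: harm; by rewrite -dk addSn ltnS leq_addl.
have /choice[c cP] := approx.
have [|u [_ uc]] := compact_unit_box (F := c @ \oo) _.
  by exists 0%N => // n _; have [] := cP n.
have lim_closed (C : set weight_space) N : closed C ->
    (forall n, (N <= n)%N -> C (c n)) -> C u.
  move=> clC Cc; apply: clC; move: uc; rewrite clusterE; apply.
  by exists N => // n; exact: Cc.
exists u.
  split=> [i||n].
  - apply: (lim_closed [set u | 0 <= u i] 0%N) => [|n _]; last first.
      by have [_ c0 _ _ _] := cP n; exact: c0.
    apply: closed_superlevel; exact: continuous_coordinate.
  - apply: (lim_closed [set u | u (at_level (root_vertex B)) = 1] 0%N)
      => [|n _].
      by apply: closed_level; exact: continuous_coordinate.
    by have [] := cP n.
  - apply/harmonic_defect => v.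
    apply: (lim_closed [set u | defect v u = 0] n) => [|m le_nm].
      apply: closed_level; exact: continuous_defect.
    have [_ _ _ harm _] := cP m; apply: (harmonic_defect (c m) n).1 v.
    exact: harm.
move=> n.
apply: (lim_closed [set u | eps <= mass u n (stay S n)] n) => [|m le_nm].
  apply: closed_superlevel; exact: continuous_mass.
by have [_ _ _ _] := cP m; apply; exact: leqW.
Qed.

End WeightSpace.

(** * Ergodicity of extreme measures *)

Section Conditioning.
Variables (R : realType) (B : bratteli) (mu : probability (borel_bpath B) R).
Hypothesis mu_inv : tail_invariant mu.

Lemma conditional_measure A :
  @measurable _ (borel_bpath B) A -> tail_closed A -> mu A != 0%E ->
  exists2 nu : probability (borel_bpath B) R, tail_invariant nu &
    forall E, @measurable _ (borel_bpath B) E ->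
      mu (E `&` A) = (fine (mu A) * fine (nu E))%:E.
Proof.
move=> mA tA muA0.
have muA_fin : mu A \is a fin_num by exact: fin_num_measure.
have fmuA0 : fine (mu A) != 0 by rewrite fine_eq0.
pose nu : probability (borel_bpath B) R := mnormalize (mrestr mu mA) point.
have nuE E : nu E = (mu (E `&` A) * (fine (mu A))^-1%:E)%E.
  have restrT : mrestr mu mA setT = mu A by rewrite /mrestr setTI.
  rewrite /nu /= /mnormalize /= restrT ifF//.
  by rewrite (negbTE muA0)/= lt_eqF// -ge0_fin_numE.
exists nu.
  move=> n w p q /paths_to_end[fp endp] /paths_to_end[fq endq].
  by rewrite !nuE (tail_closed_invariant mu_inv mA tA fp fq)// endp endq.
move=> E mE; have muEA_fin : mu (E `&` A) \is a fin_num.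
  by apply: fin_num_measure; exact: measurableI.
rewrite nuE -{1 2}(fineK muEA_fin) -EFinM /= mulrCA divff// mulr1//.
Qed.

Variable S : vertex_subdiagram B.

Lemma measurable_stay n : @measurable _ (borel_bpath B) (stay S n).
Proof. by apply: measurable_finite_stage; exists n; exact: determined_stay. Qed.

Lemma measurable_sub_bpaths : @measurable _ (borel_bpath B) (sub_bpaths S).
Proof.
rewrite sub_bpathsE; apply: (@bigcap_measurable _ (borel_bpath B)) => // k _.
exact: measurable_stay.
Qed.

(** Continuity from above along the decreasing sets of paths that stay in the
    subdiagram for [n] steps. *)
Lemma measure_sub_bpaths : mu (sub_bpaths S) =
  (inf (range (fun n => mass (weight_of mu) n (stay S n))))%:E.
Proof.
have [u0 _ harm] := weight_weight_of mu_inv.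
have stays n : mu (stay S n) = (mass (weight_of mu) n (stay S n))%:E.
  by apply: measure_mass => //; exact: determined_stay.
have cvg_mu : mu (stay S n) @[n --> \oo] --> mu (sub_bpaths S).
  rewrite sub_bpathsE; apply: nonincreasing_cvg_mu.
  - by rewrite -ge0_fin_numE// fin_num_measure//; exact: measurable_stay.
  - exact: measurable_stay.
  - by rewrite -sub_bpathsE; exact: measurable_sub_bpaths.
  - by move=> m n le_mn; apply/subsetPset; exact: stay_le.
have cvg_mass : mass (weight_of mu) n (stay S n) @[n --> \oo] -->
    inf (range (fun n => mass (weight_of mu) n (stay S n))).
  apply: nonincreasing_cvgn.
    apply/nonincreasing_seqP => n; exact: mass_stayS.
  by exists 0 => _ [n _ <-]; exact: mass_ge0.
apply: (cvg_unique _ cvg_mu) => //; apply: cvg_EFin.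
  by apply: nearW => n; rewrite stays.
apply: cvg_trans cvg_mass; apply: near_eq_cvg; apply: nearW => n.
by rewrite /= stays.
Qed.

End Conditioning.

Section Main.
Variables (R : realType) (B : bratteli) (S : vertex_subdiagram B).

(** The mass of the paths staying in the subdiagram up to level [n] is the mean
    of the ratios with respect to the probability weights h_w u(w). *)
Lemma small_ratio_null (mu : probability (borel_bpath B) R) :
  tail_invariant mu ->
  (forall eps : R, 0 < eps -> exists2 n : nat, (0 < n)%N &
      forall w : vertex B n, w \in vset S n ->
        (sub_height S w)%:R / (height w)%:R < eps) ->
  mu (sub_bpaths S) = 0%E.
Proof.
move=> mu_inv small; have wu := weight_weight_of mu_inv; have [u0 _ _] := wu.
have mS := @measurable_sub_bpaths B S.
have muS_fin : mu (sub_bpaths S) \is a fin_num by exact: fin_num_measure.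
apply/eqP; rewrite -fine_eq0// eq_le fine_ge0// andbT leNgt.
apply/negP => muS_gt0.
pose eps := fine (mu (sub_bpaths S)) / 2.
have eps0 : 0 < eps by rewrite divr_gt0.
have [[//|n] _ ratio] := small _ eps0.
have : fine (mu (sub_bpaths S)) <= eps.
  apply: (@le_trans _ _ (mass (weight_of mu) n.+1 (stay S n.+1))).
    rewrite -lee_fin fineK// -measure_mass//; last exact: determined_stay.
    apply: le_measure; rewrite ?inE//; first exact: measurable_stay.
    by rewrite sub_bpathsE => x; exact.
  rewrite -[leRHS]mulr1 -(weight_total wu n.+1) mass_setT mass_stay mulr_sumr.
  apply: ler_sum => w _; rewrite mulrA ler_wpM2r//.
  have [Sw|nSw] := boolP (w \in vset S n.+1); last first.
    by rewrite sub_height_notin//; apply: mulr_ge0 => //; exact/ltW.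
  by rewrite -ler_pdivrMr ?ltr0n ?height_gt0//; exact/ltW/ratio.
rewrite /eps; lra.
Qed.

(** The functionals to be maximised in turn: first the measure of the paths in
    the subdiagram, then all coordinates along an enumeration of the
    vertices. *)
Definition observable (k : nat) (u : weight_space R B) : R :=
  if k is k'.+1
  then if unpickle k' is Some i then u (i : pvertex B) else 0
  else inf (range (fun n => mass u n (stay S n))).

Lemma usc_observable k : usc_on (@weights R B) (observable k).
Proof.
move=> c; case: k => [|k] /=; last first.
  apply: closedI; first exact: closed_weights.
  apply: closed_superlevel.
  case: unpickle => [i|]; first exact: continuous_coordinate.
  by move=> u; exact: cst_continuous.
rewrite (_ : _ `&` _ =
  @weights R B `&` \bigcap_n [set u | c <= mass u n (stay S n)]).
  apply: closedI; first exact: closed_weights.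
  apply: closed_bigI => n _; apply: closed_superlevel.
  exact: continuous_mass.
apply/seteqP; split=> u [wu cu]; split=> //; have [u0 _ _] := wu.
  move=> n _ /=; apply: le_trans cu _; apply: ge_inf; last by exists n.
  by exists 0 => _ [m _ <-]; exact: mass_ge0.
apply: lb_le_inf; first by exists (mass u 0 (stay S 0)); exists 0%N.
by move=> _ [n _ <-]; exact: cu.
Qed.

(** Each observable is the probability of a fixed event, hence affine in the
    measure; for the infimum defining the first one this is not visible from
    its formula. *)
Definition event (k : nat) : set (bpath B) :=
  if k is k'.+1 then
    if unpickle k' : option (pvertex B) is Some i
    then cylinder (projT1 (cid (@paths_toP B (tag i) (tagged i)))) else set0
  else sub_bpaths S.

Lemma measurable_event k : @measurable _ (borel_bpath B) (event k).
Proof.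
case: k => [|k] /=; first exact: measurable_sub_bpaths.
by case: unpickle => [i|]; [exact: measurable_cylinder | exact: measurable0].
Qed.

Lemma observable_weight_of (nu : probability (borel_bpath B) R) k :
  tail_invariant nu -> observable k (weight_of nu) = fine (nu (event k)).
Proof.
move=> nu_inv; case: k => [|k] /=; first by rewrite measure_sub_bpaths.
by case: unpickle => [i|]//; rewrite measure0.
Qed.

(** An extreme point [u] for the observables gives an ergodic measure, because
    conditioning on a tail-closed set and on its complement writes the measure
    as a convex combination of invariant ones. *)
Lemma exists_ergodic (u0 : weight_space R B) : compact [set: bpath B] ->
  weight u0 -> exists mu : probability (borel_bpath B) R,
    [/\ tail_invariant mu, tail_ergodic mu &
        ((observable 0 u0)%:E <= mu (sub_bpaths S))%E].
Proof.
move=> compactB wu0.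
have [|u [wu umax uext]] := extreme_point (@compact_weights R B)
  (@closed_weights R B) _ usc_observable; first by exists u0.
have [mu muE] := weight_measure wu compactB.
have mu_inv : tail_invariant mu.
  move=> n w p q /paths_to_end[fp endp] /paths_to_end[fq endq].
  by rewrite !muE// endp endq.
have def_u : weight_of mu = u.
  apply/funext => -[n v]; rewrite /weight_of /=.
  by case: cid => p /= /paths_to_end[fp <-]; rewrite muE.
exists mu; split=> //; last first.
  have := umax _ wu0; rewrite -{1}def_u observable_weight_of// => le_u0.
  rewrite -lee_fin fineK ?fin_num_measure// in le_u0.
  exact: measurable_sub_bpaths.
move=> A mA tA.
have [->|muA0] := eqVneq (mu A) 0%E; first by left.
have [->|muA1] := eqVneq (mu A) 1%E; [by right | exfalso].
have muA_fin : mu A \is a fin_num by exact: fin_num_measure.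
have mAc : @measurable _ (borel_bpath B) (~` A) by exact: measurableC.
have tAc : tail_closed (~` A).
  by move=> x y [N xy] nAx Ay; apply: nAx; apply: tA Ay; exists N => i /xy.
have muAc : mu (~` A) = (1 - fine (mu A))%:E.
  by rewrite probability_setC// EFinB fineK.
have muAc0 : mu (~` A) != 0%E.
  by rewrite muAc eqe subr_eq0 eq_sym -eqe fineK.
have [nu1 inv1 nu1E] := conditional_measure mu_inv mA tA muA0.
have [nu2 inv2 nu2E] := conditional_measure mu_inv mAc tAc muAc0.
have eq_obs k : observable k (weight_of nu1) = observable k u.
  apply: (uext (fine (mu A)) _ (weight_of nu2)).
  - rewrite fine_gt0 /=; last by rewrite lt0e muA0 measure_ge0 -ge0_fin_numE.
    rewrite -lte_fin fineK// lt_neqAle muA1/=; exact: probability_le1.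
  - exact: weight_weight_of.
  - exact: weight_weight_of.
  move=> j; rewrite -def_u !observable_weight_of//.
  have mE := measurable_event j.
  have := nu2E _ mE; rewrite muAc /= => nu2j.
  apply: EFin_inj; rewrite EFinD -nu1E// -nu2j fineK ?fin_num_measure//.
  rewrite -setDE addeC; exact: measureDI.
have def1 : weight_of nu1 = u.
  apply/funext => i; have := eq_obs (pickle i).+1.
  by rewrite /= pickleK.
have fmuA0 : fine (mu A) != 0 by rewrite fine_eq0.
have : nu1 A = mu A.
  apply: (eq_measure_cylinder (N := 0)) => //.
    by rewrite [X in (X < _)%E]probability_setT ltry.
  by move=> n p _ fp; rewrite /= weight_ofE// def1 muE.
move=> nu1A; have := nu1E _ mA; rewrite setIid nu1A => muA_sq.
have /eqP : fine (mu A) * 1 = fine (mu A) * fine (mu A).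
  by apply: EFin_inj; rewrite -muA_sq mulr1 fineK.
rewrite (inj_eq (mulfI fmuA0)) eq_sym -eqe fineK//; exact/negP.
Qed.

End Main.

Theorem theorem4p4 (R : realType) (B : bratteli) (B_simple : simple B)
    (B_cantor : cantor_like (bpath B)) (S : vertex_subdiagram B) :
  (forall mu : probability (borel_bpath B) R,
      tail_invariant mu -> tail_ergodic mu -> mu (sub_bpaths S) = 0%E) <->
  (forall eps : R, 0 < eps -> exists2 n : nat, (0 < n)%N &
      forall w : vertex B n, w \in vset S n ->
        (sub_height S w)%:R / (height w)%:R < eps).
Proof.
split=> [null eps eps0|small mu mu_inv _]; last exact: small_ratio_null.
have [_ compactB _ _] := B_cantor.
apply: contrapT => no_n.
have [n n0|u wu umass] := @exists_weight R B S eps.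
  apply: contrapT => no_w; apply: no_n; exists n => // w Sw.
  by rewrite ltNge; apply/negP => le_eps; apply: no_w; exists w.
have [mu [mu_inv mu_erg]] := exists_ergodic S compactB wu.
rewrite null// lee_fin; apply/negP; rewrite -ltNge; apply: lt_le_trans eps0 _.
apply: lb_le_inf; first by exists (mass u 0 (stay S 0)); exists 0%N.
by move=> _ [n _ <-]; exact: umass.
Qed.
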